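(* Let $A$ be a predomain. Then $\mathrm{Stab}(A)$ is a submonoid of $(\Sigma,\vee,\bot)$, and the assignment $\phi\parallel a := (\phi\vee{\downarrow} a,\ [\phi\hookrightarrow\star,\ {\downarrow}a\hookrightarrow a])$ for $\phi:\mathrm{Stab}(A)$, $a:\mathsf{L}A$ — i.e. the partial element with support $\phi\vee{\downarrow}a$ whose value is the unique element $\star$ of $A$ under $\phi$ and the value of $a$ under ${\downarrow}a$ — is a well-defined function $\mathrm{Stab}(A)\times\mathsf{L}A\to\mathsf{L}A$ satisfying $\bot\parallel a=a$ and $\phi\parallel(\psi\parallel a)=(\phi\vee\psi)\parallel a$.
   Context: Work internally in a Grothendieck topos with a dominance $\Sigma$ ($\top:1\to\Sigma$ classifying a class of monos closed under pullback, identities and composition) such that $\Sigma$ has finite joins $\vee,\bot$ preserved by the inclusion $\Sigma\subseteq\Omega$. $\mathsf{L}A=\sum_{\phi:\Sigma}A^\phi$; for $a:\mathsf{L}A$, ${\downarrow}a:\Sigma$ is its support. Predomains: with $\omega$ the initial $\mathsf{L}$-algebra, $\bar\omega$ the final $\mathsf{L}$-coalgebra and $\iota:\omega\to\bar\omega$ the canonical map, $E$ is complete if internally orthogonal to $\iota$, and a predomain if $\mathsf{L}E$ is complete. For a proposition $\phi$, $A$ is $\phi$-sealed if the projection $A\times\phi\to\phi$ is an isomorphism (so under $\phi$, $A$ has a unique element $\star$). The stabilizer $\mathrm{Stab}(A)\subseteq\Sigma$ is the subobject of those $\phi:\Sigma$ such that $A$ is $\phi$-sealed. *)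

(* Defs.v *)
(* We work in the internal language of the topos,
   rendered as Rocq's type theory: types = objects, Prop = Omega.
   (Extensionality / unique choice, valid in any topos, are available as
   whitelisted axioms for the later proof.) *)

Record Dominance := {
  isSig : Prop -> Prop;
  isSig_top : isSig True;
  (* closure under composition (dependent conjunction) *)
  isSig_dsum : forall p q : Prop, isSig p -> (p -> isSig q) -> isSig (p /\ q);
  (* finite joins of Sigma, computed as in Omega *)
  isSig_bot : isSig False;
  isSig_join : forall p q : Prop, isSig p -> isSig q -> isSig (p \/ q)
}.

Definition Sig (D : Dominance) : Type := { p : Prop | isSig D p }.
Definition sprop {D : Dominance} (s : Sig D) : Prop := proj1_sig s.
Definition sbot (D : Dominance) : Sig D := exist _ False (isSig_bot D).
Definition sjoin {D : Dominance} (s t : Sig D) : Sig D :=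
  exist _ (sprop s \/ sprop t) (isSig_join D _ _ (proj2_sig s) (proj2_sig t)).

Definition L (D : Dominance) (A : Type) : Type := { phi : Sig D & sprop phi -> A }.
Definition supp {D : Dominance} {A : Type} (a : L D A) : Sig D := projT1 a.
Definition val {D : Dominance} {A : Type} (a : L D A) : sprop (supp a) -> A := projT2 a.
Definition Lmap {D : Dominance} {A B : Type} (f : A -> B) (a : L D A) : L D B :=
  existT _ (supp a) (fun p => f (val a p)).

(** omega (initial L-algebra), omegabar (final L-coalgebra) and the canonical
    map iota : omega -> omegabar (the unique map with
    coalg ∘ iota ∘ alg = L iota, i.e. the L-algebra map into omegabar viewed
    as an algebra via coalg^{-1}; unique by initiality). *)
Record SDTStructure (D : Dominance) := {
  omega : Type;
  alg : L D omega -> omega;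
  alg_initial : forall (B : Type) (b : L D B -> B),
      exists! h : omega -> B, forall x, h (alg x) = b (Lmap h x);
  omegabar : Type;
  coalg : omegabar -> L D omegabar;
  coalg_final : forall (B : Type) (c : B -> L D B),
      exists! h : B -> omegabar, forall x, coalg (h x) = Lmap h (c x);
  iota : omega -> omegabar;
  iota_spec : forall x, coalg (iota (alg x)) = Lmap iota x
}.

Arguments omega {D}. Arguments omegabar {D}. Arguments iota {D}.

Definition complete {D : Dominance} (S : SDTStructure D) (E : Type) : Prop :=
  forall f : omega S -> E, exists! g : omegabar S -> E, forall x, g (iota S x) = f x.

Definition predomain {D : Dominance} (S : SDTStructure D) (A : Type) : Prop :=
  complete S (L D A).

(** A is phi-sealed: the projection A × phi -> phi is an isomorphism, i.e. it
    has an inverse p |-> (s p, p). *)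
Definition sealed (A : Type) (phi : Prop) : Prop :=
  exists s : phi -> A, forall (a : A) (p : phi), s p = a.

Definition inStab {D : Dominance} (A : Type) (phi : Sig D) : Prop :=
  sealed A (sprop phi).

(* Main.v *)
(* A is φ-sealed exactly when A is a singleton under φ, and singletons are
   closed under ⊥ and ∨, so Stab(A) is a submonoid.  The value of φ ∥ a is
   pinned down uniquely on its support (it is ⋆ under φ, the value of a under
   ↓a, and the two agree where both hold since A is a singleton under φ), so it
   exists by unique choice; the laws then follow by comparing supports and
   values of partial elements. *)

Require Import Defs.
From Stdlib Require Import Description ProofIrrelevance PropExtensionality
  FunctionalExtensionality.

Lemma L_ext {D : Dominance} {A : Type} (a b : L D A) :
  (sprop (supp a) <-> sprop (supp b)) ->
  (forall p q, val a p = val b q) -> a = b.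
Proof.
  destruct a as [[P hP] f], b as [[Q hQ] g]; unfold supp, val, sprop; simpl.
  intros HPQ Hv.
  assert (P = Q) by (apply propositional_extensionality; exact HPQ); subst Q.
  assert (hP = hQ) by apply proof_irrelevance; subst hQ.
  f_equal. apply functional_extensionality. intro p. apply Hv.
Qed.

Lemma sealedP (A : Type) (P : Prop) :
  sealed A P <-> (P -> exists x : A, forall y, y = x).
Proof.
  split.
  - intros [s Hs] p. exists (s p). intro y. symmetry. apply Hs.
  - intros Hsing.
    assert (Hu : forall p : P, exists! x : A, forall y, y = x).
    { intro p. destruct (Hsing p) as [x Hx].
      exists x. split; [exact Hx | intros x' _; symmetry; apply Hx]. }
    exists (fun p => proj1_sig (constructive_definite_description _ (Hu p))).
    intros a p. symmetry.
    exact (proj2_sig (constructive_definite_description _ (Hu p)) a).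
Qed.

Lemma sealed_eq (A : Type) (P : Prop) : sealed A P -> P -> forall x y : A, x = y.
Proof. intros [s Hs] p x y. rewrite <- (Hs x p), <- (Hs y p). reflexivity. Qed.

Lemma sealed_False (A : Type) : sealed A False.
Proof. apply sealedP. intros []. Qed.

Lemma sealed_or (A : Type) (P Q : Prop) :
  sealed A P -> sealed A Q -> sealed A (P \/ Q).
Proof.
  rewrite !sealedP. intros HP HQ [p | q]; [exact (HP p) | exact (HQ q)].
Qed.

Section Parallel.

Context {D : Dominance} {A : Type}.

Definition par_val (phi : Sig D) (a : L D A) (x : A) : Prop :=
  (sprop phi -> forall y, y = x) /\ (forall r, val a r = x).

Lemma par_val_unique (phi : Sig D) (h : inStab A phi) (a : L D A)
  (q : sprop (sjoin phi (supp a))) : exists! x, par_val phi a x.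
Proof.
  destruct q as [p | r].
  - destruct (proj1 (sealedP A _) h p) as [x Hx].
    exists x. split; [split; [intros _; exact Hx | intro r; apply Hx] |].
    intros x' _. symmetry. apply Hx.
  - exists (val a r). split.
    + split.
      * intros p y. apply (sealed_eq A _ h p).
      * intro r'. rewrite (proof_irrelevance _ r' r). reflexivity.
    + intros x' [_ Hx']. apply Hx'.
Qed.

Definition par (phi : Sig D) (h : inStab A phi) (a : L D A) : L D A :=
  existT _ (sjoin phi (supp a))
    (fun q => proj1_sig (constructive_definite_description _ (par_val_unique phi h a q))).

Lemma par_valP (phi : Sig D) (h : inStab A phi) (a : L D A) q :
  par_val phi a (val (par phi h a) q).
Proof. exact (proj2_sig (constructive_definite_description _ _)). Qed.

Lemma par_val_eq (phi : Sig D) (h : inStab A phi) (a : L D A) q x :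
  par_val phi a x -> val (par phi h a) q = x.
Proof.
  intro Hx. destruct (par_val_unique phi h a q) as [x0 [_ Hx0]].
  rewrite <- (Hx0 x Hx). symmetry. apply Hx0, par_valP.
Qed.

Lemma par_bot (h : inStab A (sbot D)) (a : L D A) : par (sbot D) h a = a.
Proof.
  apply L_ext.
  - unfold sprop; simpl. tauto.
  - intros p q. symmetry. apply (proj2 (par_valP _ h a p)).
Qed.

Lemma par_join (phi psi : Sig D) (hphi : inStab A phi) (hpsi : inStab A psi)
  (hj : inStab A (sjoin phi psi)) (a : L D A) :
  par phi hphi (par psi hpsi a) = par (sjoin phi psi) hj a.
Proof.
  apply L_ext.
  - unfold sprop; simpl. tauto.
  - intros p q. symmetry. apply par_val_eq. split.
    + intros pq y. apply (sealed_eq A _ hj pq).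
    + intro r. rewrite <- (proj2 (par_valP _ hphi _ p) (or_intror r)).
      apply (proj2 (par_valP _ hpsi a _)).
Qed.

End Parallel.

Theorem mainTheorem3 (D : Dominance) (S : SDTStructure D) (A : Type)
  (HA : predomain S A) :
  (inStab A (sbot D) /\
   forall phi psi : Sig D, inStab A phi -> inStab A psi -> inStab A (sjoin phi psi)) /\
  exists par : forall phi : Sig D, inStab A phi -> L D A -> L D A,
    (forall (phi : Sig D) (h : inStab A phi) (a : L D A),
        supp (par phi h a) = sjoin phi (supp a) /\
        (forall (q : sprop (supp (par phi h a))), sprop phi ->
           forall star : A, val (par phi h a) q = star) /\
        (forall (q : sprop (supp (par phi h a))) (r : sprop (supp a)),
           val (par phi h a) q = val a r)) /\
    (forall (h : inStab A (sbot D)) (a : L D A), par (sbot D) h a = a) /\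
    (forall (phi psi : Sig D) (hphi : inStab A phi) (hpsi : inStab A psi)
            (hj : inStab A (sjoin phi psi)) (a : L D A),
        par phi hphi (par psi hpsi a) = par (sjoin phi psi) hj a).
Proof.
  split.
  - split; [apply sealed_False | intros phi psi; apply sealed_or].
  - exists (@par D A). split; [| split; [exact par_bot | exact par_join]].
    intros phi h a. split; [reflexivity | split].
    + intros q p star. symmetry. apply (proj1 (par_valP phi h a q) p).
    + intros q r. symmetry. apply (proj2 (par_valP phi h a q)).
Qed.
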